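(* Let $\mathsf{L}$ be either $\mathbf{MT_0}$ or $\mathbf{MID}$, with its Hilbert-style system. For all $\mathsf{L}$-formulas $\phi$ and $\psi$: if $\phi\vdash_{\mathsf{L}}\psi$, then $\phi\models\psi$.
   Context: **Languages.** Fix a set $\mathrm{Prop}$ of propositional variables $p,q,\dots$. $\mathbf{MT_0}$: classical formulas are $\alpha::=p\mid\bot\mid\alpha\wedge\alpha\mid\alpha\otimes\alpha\mid\alpha\to\alpha\mid\Box\alpha\mid\Diamond\alpha$; formulas are $\phi::=\alpha\mid\; =\!(\alpha_1,\dots,\alpha_n,\beta)\mid\phi\wedge\phi\mid\phi\otimes\phi\mid\phi\vee\phi\mid\phi\to\phi\mid\Box\phi\mid\Diamond\phi$, where $n\ge 0$ and $\alpha,\alpha_i,\beta$ are classical. $\mathbf{MID}$: the same without $\otimes$, i.e. classical formulas are $\alpha::=p\mid\bot\mid\alpha\wedge\alpha\mid\alpha\to\alpha\mid\Box\alpha\mid\Diamond\alpha$ and formulas are $\phi::=\alpha\mid\; =\!(\alpha_1,\dots,\alpha_n,\beta)\mid\phi\wedge\phi\mid\phi\vee\phi\mid\phi\to\phi\mid\Box\phi\mid\Diamond\phi$. $\neg\phi$ abbreviates $\phi\to\bot$, and $\phi\leftrightarrow\psi$ abbreviates $(\phi\to\psi)\wedge(\psi\to\phi)$. **Team semantics.** A Kripke model is $\mathfrak{M}=(W,R,V)$ with $W\neq\emptyset$, $R\subseteq W\times W$, $V:\mathrm{Prop}\to\wp(W)$. A team is any $X\subseteq W$. $R(X)=\{w\in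 W\mid\exists v\in X,\ vRw\}$, $R(w)=R(\{w\})$; $XRY$ means $Y\subseteq R(X)$ and $Y\cap R(w)\ne\emptyset$ for every $w\in X$. Satisfaction: - $\mathfrak{M},X\models p$ iff $X\subseteq V(p)$; $\mathfrak{M},X\models\bot$ iff $X=\emptyset$. - $\mathfrak{M},X\models\phi\wedge\psi$ iff both hold on $X$; $\mathfrak{M},X\models\phi\vee\psi$ iff $\mathfrak{M},X\models\phi$ or $\mathfrak{M},X\models\psi$. - $\mathfrak{M},X\models\phi\otimes\psi$ iff $X=Y\cup Z$ for some $Y,Z\subseteq X$ with $\mathfrak{M},Y\models\phi$, $\mathfrak{M},Z\models\psi$. - $\mathfrak{M},X\models\phi\to\psi$ iff for all $Y\subseteq X$, $\mathfrak{M},Y\models\phi$ implies $\mathfrak{M},Y\models\psi$. - $\mathfrak{M},X\models\Box\phi$ iff $\mathfrak{M},R(X)\models\phi$; $\mathfrak{M},X\models\Diamond\phi$ iff there is $Y\subseteq W$ with $XRY$ and $\mathfrak{M},Y\models\phi$. - $\mathfrak{M},X\models\;=\!(\alpha_1,\dots,\alpha_n,\beta)$ iff for all $w,u\in X$: if ($\mathfrak{M},\{w\}\models\alpha_i\Leftrightarrow\mathfrak{M},\{u\}\models\alpha_i$) for all $1\le i\le n$, then ($\mathfrak{M},\{w\}\models\beta\Leftrightarrow\mathfrak{M},\{u\}\models\beta$). $\phi\models\psi$ means: for all models $\mathfrak{M}$ and teams $X$, $\mathfrak{M},X\models\phi$ implies $\mathfrak{M},X\models\psi$. **Hilbert system of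 $\mathbf{MT_0}$.** Axioms: all instances in the language (with $\phi,\psi,\chi,\theta$ arbitrary formulas and $\alpha,\alpha_i,\beta$ classical formulas) of 1. $\phi\to(\psi\to\phi)$; $(\phi\to(\psi\to\chi))\to((\phi\to\psi)\to(\phi\to\chi))$; $\phi\wedge\psi\to\phi$; $\phi\wedge\psi\to\psi$; $\phi\to(\chi\to(\phi\wedge\chi))$; $\phi\to\phi\vee\psi$; $\psi\to\phi\vee\psi$; $(\phi\to\chi)\to((\psi\to\chi)\to(\phi\vee\psi\to\chi))$; $\bot\to\phi$; 2. $(\alpha\to(\phi\vee\psi))\to(\alpha\to\phi)\vee(\alpha\to\psi)$; $\neg\neg\alpha\to\alpha$; 3. $\Box(\phi\to\psi)\to(\Box\phi\to\Box\psi)$; $\Box(\phi\to\psi)\to(\Diamond\phi\to\Diamond\psi)$; $\neg\Diamond\bot$; $\Diamond(\phi\vee\psi)\to(\Diamond\phi\vee\Diamond\psi)$; $(\Diamond\phi\to\Box\psi)\to\Box(\phi\to\psi)$; 4. $=\!(\alpha_1,\dots,\alpha_k,\beta)\leftrightarrow\big((\alpha_1\vee\neg\alpha_1)\wedge\dots\wedge(\alpha_k\vee\neg\alpha_k)\to(\beta\vee\neg\beta)\big)$ (right side read as $\beta\vee\neg\beta$ if $k=0$); 5. $\phi\to\phi\otimes\psi$; $(\phi\to\alpha)\to((\psi\to\alpha)\to(\phi\otimes\psi\to\alpha))$; $(\phi\to\chi)\to((\psi\to\theta)\to(\phi\otimes\psi\to\chi\otimes\theta))$; $\phi\otimes\psi\to\psi\otimes\phi$;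 $\phi\otimes(\psi\otimes\chi)\to(\phi\otimes\psi)\otimes\chi$; $\phi\otimes(\psi\vee\chi)\to(\phi\otimes\psi)\vee(\phi\otimes\chi)$; 6. $\neg\Box\alpha\to\Diamond\neg\alpha$; $\Box(\phi\vee\psi)\to(\Box\phi\vee\Box\psi)$. Rules: Modus Ponens $\phi,\phi\to\psi/\psi$ and Necessitation $\phi/\Box\phi$. The system of $\mathbf{MID}$ is the same with formulas of $\mathbf{MID}$ and without the axioms in group 5. $\vdash_{\mathsf L}\phi$ means $\phi$ is a theorem; $\phi\vdash_{\mathsf L}\psi$ means $\psi$ is derivable from the assumption $\phi$, where Necessitation is applied only to theorems (equivalently, $\vdash_{\mathsf L}\phi\to\psi$). *)

(* Defs.v *)
From Stdlib Require List.
From mathcomp Require Import ssreflect ssrfun ssrbool seq.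
From mathcomp Require Import boolp classical_sets.

Set Implicit Arguments.
Unset Strict Implicit.
Unset Printing Implicit Defensive.

Local Open Scope classical_set_scope.

Inductive logic := MT0 | MID.

Definition has_tensor (L : logic) : bool := if L is MT0 then true else false.

(* Raw syntax shared by both logics. The arguments of [Dep] are arbitrary here;
   [formula] below restricts them to classical formulas, and restricts [Tens]
   to MT0. *)
Inductive form (P : Type) : Type :=
| Var of P
| Bot
| Dep of seq (form P) & form P
| And of form P & form P
| Tens of form P & form P
| Or of form P & form P
| Imp of form P & form P
| Box of form P
| Dia of form P.

Arguments Bot {P}.

Declare Scope form_scope.
Delimit Scope form_scope with form.
Bind Scope form_scope with form.
Notation "⊥" := Bot (at level 0) : form_scope.
Notation "□ φ" := (Box φ) (at level 20, right associativity, format "□ φ") : form_scope.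
Notation "◇ φ" := (Dia φ) (at level 20, right associativity, format "◇ φ") : form_scope.
Notation "φ ⊓ ψ" := (And φ ψ) (at level 40, left associativity) : form_scope.
Notation "φ ⊗ ψ" := (Tens φ ψ) (at level 40, left associativity) : form_scope.
Notation "φ ⊔ ψ" := (Or φ ψ) (at level 50, left associativity) : form_scope.
Notation "φ ⇒ ψ" := (Imp φ ψ) (at level 55, right associativity) : form_scope.
Notation "∼ φ" := (Imp φ Bot) (at level 20, right associativity, format "∼ φ") : form_scope.
Notation "φ ⇔ ψ" := (And (Imp φ ψ) (Imp ψ φ)) (at level 56, no associativity) : form_scope.

Fixpoint classical (P : Type) (L : logic) (φ : form P) : bool :=
  match φ with
  | Var _ | Bot => true
  | Tens α β => [&& has_tensor L, classical L α & classical L β]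
  | And α β | Imp α β => classical L α && classical L β
  | Box α | Dia α => classical L α
  | Dep _ _ | Or _ _ => false
  end.

Fixpoint formula (P : Type) (L : logic) (φ : form P) : bool :=
  match φ with
  | Var _ | Bot => true
  | Dep αs β => all (classical L) αs && classical L β
  | Tens φ ψ => [&& has_tensor L, formula L φ & formula L ψ]
  | And φ ψ | Or φ ψ | Imp φ ψ => formula L φ && formula L ψ
  | Box φ | Dia φ => formula L φ
  end.

Lemma classical_formula (P : Type) (L : logic) (α : form P) :
  classical L α -> formula L α.
Proof.
elim: α => //= [α IHα β IHβ | α IHα β IHβ | α IHα β IHβ].
- by move=> /andP[/IHα -> /IHβ ->].
- by move=> /and3P[-> /IHα -> /IHβ ->].
- by move=> /andP[/IHα -> /IHβ ->].
Qed.

Record kripke (P : Type) : Type := Kripke {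
  world : Type;
  world_inhabited : inhabited world;
  accessible : world -> world -> Prop;
  valuation : P -> set world
}.

Section Semantics.
Variables (P : Type) (M : kripke P).
Implicit Types (X Y Z : set (world M)) (w u v : world M) (φ ψ : form P).

Definition successors X : set (world M) := [set w | exists2 v, X v & accessible v w].

Definition team_acc X Y : Prop :=
  Y `<=` successors X /\ forall w, X w -> (Y `&` successors [set w]) !=set0.

(* The premise of the dependence clause is a [foldr] so that the nested
   recursion is structural; see [sat_DepE]. *)
Fixpoint sat X φ : Prop :=
  match φ with
  | Var p => X `<=` valuation p
  | Bot => X = set0
  | Dep αs β =>
      forall w u, X w -> X u ->
        foldr (fun α Q => (sat [set w] α <-> sat [set u] α) /\ Q) True αs ->
        (sat [set w] β <-> sat [set u] β)
  | And φ ψ => sat X φ /\ sat X ψ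
  | Tens φ ψ =>
      exists Y Z, [/\ Y `<=` X, Z `<=` X, X = Y `|` Z, sat Y φ & sat Z ψ]
  | Or φ ψ => sat X φ \/ sat X ψ
  | Imp φ ψ => forall Y, Y `<=` X -> sat Y φ -> sat Y ψ
  | Box φ => sat (successors X) φ
  | Dia φ => exists2 Y, team_acc X Y & sat Y φ
  end.

Lemma sat_DepE X (αs : seq (form P)) (β : form P) :
  sat X (Dep αs β) <->
  forall w u, X w -> X u ->
    (forall α, List.In α αs -> (sat [set w] α <-> sat [set u] α)) ->
    (sat [set w] β <-> sat [set u] β).
Proof.
have foldrE w u :
    foldr (fun α Q => (sat [set w] α <-> sat [set u] α) /\ Q) True αs <->
    forall α, List.In α αs -> (sat [set w] α <-> sat [set u] α).
  elim: αs => [|a s IH] /=; first by split.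
  rewrite IH; split=> [[Ha Hs] α [<- //|]|H]; first exact: Hs.
  by split=> [|α Hα]; apply: H; [left | right].
by split=> H w u Xw Xu Hα; apply: H => //; apply/foldrE.
Qed.

End Semantics.

Definition entails (P : Type) (φ ψ : form P) : Prop :=
  forall (M : kripke P) (X : set (world M)), sat X φ -> sat X ψ.

Definition decided (P : Type) (α : form P) : form P := (α ⊔ ∼α)%form.

(* The conjunction is bracketed to the left; it is omitted, together with the
   implication, when the dependence atom has no determining formulas. *)
Definition dep_expansion (P : Type) (αs : seq (form P)) (β : form P) : form P :=
  if αs is α :: αs' then
    Imp (foldl (@And P) (decided α) (map (@decided P) αs')) (decided β)
  else decided β.

(* Schemata range over raw formulas: [provable] keeps only the instances that
   are formulas of the logic at hand. *)
Inductive axiom (P : Type) : logic -> form P -> Prop :=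
| ax_K L φ ψ : axiom L (φ ⇒ (ψ ⇒ φ))
| ax_S L φ ψ χ : axiom L ((φ ⇒ (ψ ⇒ χ)) ⇒ ((φ ⇒ ψ) ⇒ (φ ⇒ χ)))
| ax_and_l L φ ψ : axiom L ((φ ⊓ ψ) ⇒ φ)
| ax_and_r L φ ψ : axiom L ((φ ⊓ ψ) ⇒ ψ)
| ax_and_i L φ χ : axiom L (φ ⇒ (χ ⇒ (φ ⊓ χ)))
| ax_or_l L φ ψ : axiom L (φ ⇒ (φ ⊔ ψ))
| ax_or_r L φ ψ : axiom L (ψ ⇒ (φ ⊔ ψ))
| ax_or_e L φ ψ χ : axiom L ((φ ⇒ χ) ⇒ ((ψ ⇒ χ) ⇒ ((φ ⊔ ψ) ⇒ χ)))
| ax_bot L φ : axiom L (⊥ ⇒ φ)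

| ax_split L α φ ψ : classical L α ->
    axiom L ((α ⇒ (φ ⊔ ψ)) ⇒ ((α ⇒ φ) ⊔ (α ⇒ ψ)))
| ax_dne L α : classical L α -> axiom L (∼∼α ⇒ α)

| ax_box_K L φ ψ : axiom L (□(φ ⇒ ψ) ⇒ (□φ ⇒ □ψ))
| ax_dia_K L φ ψ : axiom L (□(φ ⇒ ψ) ⇒ (◇φ ⇒ ◇ψ))
| ax_dia_bot L : axiom L (∼◇⊥)
| ax_dia_or L φ ψ : axiom L (◇(φ ⊔ ψ) ⇒ (◇φ ⊔ ◇ψ))
| ax_dia_box L φ ψ : axiom L ((◇φ ⇒ □ψ) ⇒ □(φ ⇒ ψ))

| ax_dep L αs β : all (classical L) αs -> classical L β ->
    axiom L (Dep αs β ⇔ dep_expansion αs β)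

| ax_tens_i φ ψ : axiom MT0 (φ ⇒ (φ ⊗ ψ))
| ax_tens_e φ ψ α : classical MT0 α ->
    axiom MT0 ((φ ⇒ α) ⇒ ((ψ ⇒ α) ⇒ ((φ ⊗ ψ) ⇒ α)))
| ax_tens_mono φ ψ χ θ :
    axiom MT0 ((φ ⇒ χ) ⇒ ((ψ ⇒ θ) ⇒ ((φ ⊗ ψ) ⇒ (χ ⊗ θ))))
| ax_tens_comm φ ψ : axiom MT0 ((φ ⊗ ψ) ⇒ (ψ ⊗ φ))
| ax_tens_assoc φ ψ χ : axiom MT0 ((φ ⊗ (ψ ⊗ χ)) ⇒ ((φ ⊗ ψ) ⊗ χ))
| ax_tens_or φ ψ χ :
    axiom MT0 ((φ ⊗ (ψ ⊔ χ)) ⇒ ((φ ⊗ ψ) ⊔ (φ ⊗ χ)))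

| ax_nbox L α : classical L α -> axiom L (∼□α ⇒ ◇∼α)
| ax_box_or L φ ψ : axiom L (□(φ ⊔ ψ) ⇒ (□φ ⊔ □ψ)).

Inductive provable (P : Type) (L : logic) : form P -> Prop :=
| provable_axiom φ : axiom L φ -> formula L φ -> provable L φ
| provable_mp φ ψ : provable L φ -> provable L (φ ⇒ ψ) -> provable L ψ
| provable_nec φ : provable L φ -> provable L (□φ).

(* Necessitation is available only through [provable]. *)
Inductive derivable (P : Type) (L : logic) (φ : form P) : form P -> Prop :=
| derivable_hyp : derivable L φ φ
| derivable_thm ψ : provable L ψ -> derivable L φ ψ
| derivable_mp ψ χ :
    derivable L φ ψ -> derivable L φ (ψ ⇒ χ) -> derivable L φ χ.

(* Main.v *)
(** Every formula is downward closed and holds on the empty team, and a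
    classical formula is flat: it holds on a team iff it holds on each singleton
    of the team. The first two properties validate the axioms about arbitrary
    formulas; flatness lets one pass from a team [X] to the largest subteam of
    [X] satisfying a classical formula, which validates the others. The least
    direct axiom is [(◇φ ⇒ □ψ) ⇒ □(φ ⇒ ψ)]: given [Y `<=` successors X] with
    [φ], apply the premise to the points of [X] that see [Y]. *)

Require Import Defs.
From mathcomp Require Import ssreflect ssrfun ssrbool.
From mathcomp Require Import seq boolp classical_sets.

Set Implicit Arguments.
Unset Strict Implicit.
Unset Printing Implicit Defensive.

Local Open Scope classical_set_scope.

Section Teams.
Variables (P : Type) (M : kripke P).
Implicit Types (X Y Z : set (world M)) (w u v : world M) (φ ψ α β : form P).

Lemma successorsS X Y : X `<=` Y -> successors X `<=` successors Y.
Proof. by move=> XY w [v /XY Yv vw]; exists v. Qed.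

Lemma successors0 : successors (set0 : set (world M)) = set0.
Proof. by rewrite -subset0 => w []. Qed.

Lemma successors_sub1 X w : X w -> successors [set w] `<=` successors X.
Proof. by move=> Xw; apply: successorsS => _ ->. Qed.

Lemma sat_sub φ X Y : Y `<=` X -> sat X φ -> sat Y φ.
Proof.
elim: φ X Y => [p||αs β _|φ IHφ ψ IHψ|φ IHφ ψ IHψ|φ IHφ ψ IHψ|φ _ ψ _
  |φ IHφ|φ IHφ] X Y YX /=.
- exact: subset_trans.
- by move=> X0; rewrite -subset0 -X0.
- by move=> H w u /YX Xw /YX Xu; apply: H.
- by move=> [/(IHφ _ _ YX) ? /(IHψ _ _ YX)].
- move=> [X1 [X2 [_ _ XE sat1 sat2]]].
  exists (Y `&` X1), (Y `&` X2); split; try exact: subIsetl.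
  + by rewrite -setIUr -XE; apply/esym/setIidPl.
  + by apply: IHφ sat1; exact: subIsetr.
  + by apply: IHψ sat2; exact: subIsetr.
- by move=> [/(IHφ _ _ YX)|/(IHψ _ _ YX)]; [left|right].
- by move=> H Z ZY; apply: H; exact: subset_trans YX.
- exact/IHφ/successorsS.
(* The witness for [X] may contain points not seen from [Y]; cutting it down to [successors Y]
   removes no point seen from a member of [Y]. *)
- move=> [Z [ZX XZ] satZ]; exists (Z `&` successors Y).
    split=> [|w Yw]; first exact: subIsetr.
    have [v [Zv wv]] := XZ w (YX w Yw).
    by exists v; do ! split=> //; exact: (successors_sub1 Yw).
  by apply: IHφ satZ; exact: subIsetl.
Qed.

Lemma sat_set0 φ : sat (set0 : set (world M)) φ.
Proof.
elim: φ => [p||αs β _|φ IHφ ψ IHψ|φ IHφ ψ IHψ|φ IHφ ψ IHψ|φ _ ψ IHψ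
  |φ IHφ|φ IHφ] //=.
- by exists set0, set0; rewrite setU0; split.
- by left.
- by move=> Y; rewrite subset0 => -> _.
- by rewrite successors0.
- by exists set0 => //; split=> // w [].
Qed.

(** A singleton has only itself and the empty team as subteams, so on it implication behaves
    classically. *)
Lemma sat1_imp φ ψ w :
  (sat [set w] φ -> sat [set w] ψ) -> sat [set w] (Imp φ ψ).
Proof.
by move=> H Y /subset_set1[-> _| -> /H //]; exact: sat_set0.
Qed.

Lemma sat1_not φ w : sat [set w] (Imp φ Bot) <-> ~ sat [set w] φ.
Proof.
split=> [H satw|H]; last by apply: sat1_imp.
by have /= /seteqP[/(_ w erefl)] := H _ (@subset_refl _ _) satw.
Qed.

(** Only one direction of flatness; the other is an instance of [sat_sub]. *)
Definition flat α := forall X, (forall w, X w -> sat [set w] α) -> sat X α.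

Definition satisfying α : set (world M) := [set w | sat [set w] α].

Lemma sat_satisfying α X : sat X α -> X `<=` satisfying α.
Proof. by move=> satX w Xw; apply: sat_sub satX => _ ->. Qed.

Lemma classical_flat L α : classical L α -> flat α.
Proof.
elim: α => [p||//|α IHα β IHβ|α IHα β IHβ|//|α IHα β IHβ|α IHα|α IHα] /=.
- by move=> _ X H w Xw; exact: (H w Xw).
- by move=> _ X H /=; rewrite -subset0 => w /H /seteqP[/(_ w erefl)].
- move=> /andP[/IHα flatα /IHβ flatβ] X H.
  by split; [apply: flatα | apply: flatβ] => w /H[].
- move=> /and3P[_ /IHα flatα /IHβ flatβ] X H /=.
  (* These halves cover [X]: each point lies in one part of the split of its own singleton. *)
  exists (X `&` satisfying α), (X `&` satisfying β); split.
  + exact: subIsetl.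
  + exact: subIsetl.
  + rewrite -setIUr; apply/esym/setIidPl => w Xw.
    have [Y [Z [_ _ YZ satY satZ]]] := H w Xw.
    have : (Y `|` Z) w by rewrite -YZ.
    by case=> [/(sat_satisfying satY)|/(sat_satisfying satZ)]; [left|right].
  + by apply: flatα => w [].
  + by apply: flatβ => w [].
- move=> /andP[_ /IHβ flatβ] X H Y YX /sat_satisfying satY.
  by apply: flatβ => w Yw; exact: (H w (YX w Yw) _ (@subset_refl _ _) (satY w Yw)).
- move=> /IHα flatα X H /=; apply: flatα => w [v Xv vw].
  by apply: (@sat_satisfying α (successors [set v]) (H v Xv)); exists v.
(* The largest possible witness: all successors at which [α] holds. *)
- move=> /IHα flatα X H /=; exists (successors X `&` satisfying α).
    split=> [|w Xw]; first exact: subIsetl.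
    have [Y [Yw /(_ w erefl)[v [Yv wv]]] satY] := H w Xw.
    exists v; do ! split=> //; first exact: (successors_sub1 Xw).
    exact: (sat_satisfying satY).
  by apply: flatα => w [].
Qed.

(** Whichever disjunct holds on the largest subteam of [X] satisfying [α] passes down to every other
    such subteam. *)
Lemma flat_split α φ ψ X : flat α -> sat X (Imp α (Or φ ψ)) ->
  sat X (Or (Imp α φ) (Imp α ψ)).
Proof.
move=> flatα H.
have : sat (X `&` satisfying α) (Or φ ψ).
  by apply: H; [exact: subIsetl | apply: flatα => w []].
have subα Y : Y `<=` X -> sat Y α -> Y `<=` X `&` satisfying α.
  by move=> YX /sat_satisfying Yα; rewrite subsetI.
by case=> satX; [left|right] => Y YX /(subα _ YX) YXα; apply: sat_sub satX.
Qed.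

Lemma flat_dne α X : flat α -> sat X (Imp (Imp α Bot) Bot) -> sat X α.
Proof.
move=> flatα H; apply: flatα => w Xw; apply: contrapT => /sat1_not.
apply: (proj1 (sat1_not (Imp α Bot) w)); exact: (sat_satisfying H).
Qed.

Lemma sat_dia_box φ ψ X :
  sat X (Imp (Dia φ) (Box ψ)) -> sat X (Box (Imp φ ψ)).
Proof.
move=> H Y YX satY.
(* On [X'] the team [Y] itself witnesses [Dia φ], so the premise yields [ψ] on [successors X'],
   which contains [Y]. *)
pose X' := X `&` [set w | Y `&` successors [set w] !=set0].
have YX' : Y `<=` successors X'.
  move=> v Yv; have [w Xw wv] := YX v Yv.
  exists w => //; split=> //.
  by exists v; split=> //; exists w.
apply: (sat_sub YX'); apply: (H X'); first exact: subIsetl.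
by exists Y => //; split=> // w [].
Qed.

Lemma sat_not_box α X : flat α ->
  sat X (Imp (Box α) Bot) -> sat X (Dia (Imp α Bot)).
Proof.
(* Every point of [X] sees some point of this team: otherwise flatness would give [Box α] on its
   singleton. *)
move=> flatα H; exists (successors X `&` ~` satisfying α).
  split=> [|w Xw]; first exact: subIsetl.
  have /sat1_not nbox : sat [set w] (Imp (Box α) Bot) by apply: sat_sub H => _ ->.
  apply: contrapT => none; apply: nbox; apply: flatα => v wv.
  apply: contrapT => nv; apply: none; exists v; do ! split=> //.
  exact: (successors_sub1 Xw).
move=> Y YX /sat_satisfying Yα; rewrite /= -subset0 => w Yw.
by case: (YX w Yw) => _; apply; exact: Yα.
Qed.

(** For flat [α], [decided α] thus acts as a constancy atom; this is the link with dependence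
    atoms. *)
Lemma sat_decided α X : flat α ->
  sat X (decided α) <->
  forall w u, X w -> X u -> (sat [set w] α <-> sat [set u] α).
Proof.
move=> flatα; split=> [[satX|satX] w u Xw Xu|H].
- by split=> _; exact: (sat_satisfying satX).
- have /sat1_not nw := @sat_satisfying (Imp α Bot) X satX w Xw.
  by have /sat1_not nu := @sat_satisfying (Imp α Bot) X satX u Xu.
have [[w Xw satw]|none] := pselect (exists2 w, X w & sat [set w] α).
  by left; apply: flatα => u Xu; apply/(H w u).
right=> Y YX /sat_satisfying Yα; rewrite /= -subset0 => w Yw.
by apply: none; exists w; [exact: YX | exact: Yα].
Qed.

Lemma sat_foldl_and φ (φs : seq (form P)) X :
  sat X (foldl (@And P) φ φs) <->
  sat X φ /\ foldr (fun ψ Q => sat X ψ /\ Q) True φs.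
Proof. by elim: φs φ => [|ψ φs IH] φ /=; [tauto | rewrite IH /=; tauto]. Qed.

(** Repeats the premise of the [Dep] clause of [sat], so that the two are convertible. *)
Definition agree αs w u :=
  foldr (fun α Q => (sat [set w] α <-> sat [set u] α) /\ Q) True αs.

Lemma sat_decided_all L (αs : seq (form P)) X : all (classical L) αs ->
  foldr (fun ψ Q => sat X ψ /\ Q) True (map (@decided P) αs) <->
  forall w u, X w -> X u -> agree αs w u.
Proof.
elim: αs => [|α αs IH] //= /andP[/classical_flat flatα /IH {}IH].
rewrite IH; split=> [[/(sat_decided _ flatα) satα H] w u Xw Xu|H].
  by split; [exact: satα | exact: H].
split; first by apply/(sat_decided _ flatα) => w u Xw Xu; case: (H w u Xw Xu).
by move=> w u Xw Xu; case: (H w u Xw Xu).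
Qed.

(** The expansion says that [β] is constant on every subteam on which all of [αs] are. Two-point
    subteams already suffice to recover the dependence atom. *)
Lemma sat_dep_expansion L (αs : seq (form P)) β X :
  all (classical L) αs -> classical L β ->
  sat X (dep_expansion αs β) <-> sat X (Dep αs β).
Proof.
case: αs => [_ /classical_flat flatβ|α αs classα /classical_flat flatβ].
  rewrite (sat_decided _ flatβ) /=.
  by split=> H w u Xw Xu; [move=> _|]; exact: H.
have premE Y : sat Y (foldl (@And P) (decided α) (map (@decided P) αs)) <->
    forall w u, Y w -> Y u -> agree (α :: αs) w u.
  by rewrite sat_foldl_and; exact: (sat_decided_all Y classα).
split=> [H w u Xw Xu Hα|H Y YX /premE Yα].
  have /(sat_decided _ flatβ) : sat [set w; u] (decided β).
    apply: H; first by move=> _ [->| ->].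
    apply/premE.
    (* Constancy on the pair concerns all four ordered pairs of its points, whereas only agreement
       of [w] with [u] is given. *)
    have agree_refl v : agree (α :: αs) v v by elim: (α :: αs).
    have agree_sym v v' : agree (α :: αs) v v' -> agree (α :: αs) v' v.
      by elim: (α :: αs) => //= a s IH [av /IH]; split=> //; exact: iff_sym.
    by move=> v v' [->| ->] [->| ->] //; exact: agree_sym.
  by apply; [left | right].
apply/(sat_decided _ flatβ) => w u Yw Yu.
by apply: H; [exact: YX | exact: YX | exact: Yα].
Qed.

Lemma sat_imp_valid φ ψ X :
  (forall Y, sat Y φ -> sat Y ψ) -> sat X (Imp φ ψ).
Proof. by move=> H Y _; exact: H. Qed.

Lemma axiom_sound L φ X : Defs.axiom L φ -> sat X φ.
Proof.
case=> {L φ}.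
- by move=> _ φ ψ Y _ satY Z ZY _; exact: sat_sub satY.
- move=> _ φ ψ χ X1 _ H X2 X21 H' X3 X32 satX3.
  by apply: (H X3 _ satX3 X3) => //; [exact: subset_trans X21 | exact: H'].
- by move=> _ φ ψ Y _ [].
- by move=> _ φ ψ Y _ [].
- by move=> _ φ χ Y _ satY Z ZY satZ; split=> //; exact: sat_sub satY.
- by move=> _ φ ψ Y _; left.
- by move=> _ φ ψ Y _; right.
- move=> _ φ ψ χ X1 _ H X2 X21 H' X3 X32 [|]; last exact: H'.
  exact/H/(subset_trans X32).
- by move=> _ φ Y _ /= ->; exact: sat_set0.
- move=> L α φ ψ /classical_flat flatα.
  by apply: sat_imp_valid => Y; exact: flat_split.
- move=> L α /classical_flat flatα.
  by apply: sat_imp_valid => Y; exact: flat_dne.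
- move=> _ φ ψ Y _ H Z ZY satZ.
  by apply: (H (successors Z)) => //; exact: successorsS.
- move=> _ φ ψ Y _ H Z ZY [T [TZ ZT] satT]; exists T; first by split.
  by apply: H => //; apply: subset_trans TZ _; exact: successorsS.
- move=> _ Y _ [Z [_ YZ] /= Z0]; rewrite -subset0 => w Yw.
  by have [v []] := YZ w Yw; rewrite Z0.
- by move=> _ φ ψ Y _ [Z YZ [?|?]]; [left|right]; exists Z.
- by move=> _ φ ψ; apply: sat_imp_valid => Y; exact: sat_dia_box.
- move=> L αs β classα classβ.
  by split; apply: sat_imp_valid => Y /(sat_dep_expansion Y classα classβ).
- move=> φ ψ Y _ satY; exists Y, set0; rewrite setU0; split=> //.
  exact: sat_set0.
- move=> φ ψ α /classical_flat flatα X1 _ H X2 X21 H' X3 X32.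
  (* [α] holds on [Y] and on [Z] separately; flatness carries it over to their union. *)
  move=> [Y [Z [YX ZX XE satY satZ]]]; apply: flatα => w.
  rewrite XE => -[Yw|Zw].
    apply: (sat_satisfying _ Yw); apply: H satY.
    exact: (subset_trans YX (subset_trans X32 X21)).
  by apply: (sat_satisfying _ Zw); apply: H' satZ; exact: subset_trans ZX _.
- move=> φ ψ χ θ X1 _ H X2 X21 H' X3 X32 [Y [Z [YX ZX XE satY satZ]]].
  exists Y, Z; split=> //.
    by apply: H satY; exact: (subset_trans YX (subset_trans X32 X21)).
  by apply: H' satZ; exact: subset_trans ZX _.
- by move=> φ ψ X1 _ [Y [Z [? ? XE ? ?]]]; exists Z, Y; split=> //; rewrite setUC.
- move=> φ ψ χ X1 _ [Y [T [YX TX -> satY [Z [U [_ _ -> satZ satU]]]]]].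
  exists (Y `|` Z), U; split=> //.
  + by rewrite setUA; exact: subsetUl.
  + by rewrite setUA; exact: subsetUr.
  + by rewrite setUA.
  + by exists Y, Z.
- by move=> φ ψ χ X1 _ [Y [Z [? ? ? ? [?|?]]]]; [left|right]; exists Y, Z.
- move=> L α /classical_flat flatα.
  by apply: sat_imp_valid => Y; exact: sat_not_box.
(* Both sides unfold to the same disjunction about [successors Y]. *)
- by move=> _ φ ψ Y _.
Qed.

Lemma provable_sound L φ X : provable L φ -> sat X φ.
Proof.
(* The team stays general: Necessitation uses the induction hypothesis on [successors X]. *)
move=> prov; elim: prov X => {φ} [φ axφ _ X|φ ψ _ satφ _ satψ X|φ _ satφ X].
- exact: axiom_sound axφ.
- exact: (satψ X X (@subset_refl _ X) (satφ X)).
- exact: satφ.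
Qed.

End Teams.

Theorem theorem2p5 (P : Type) (L : logic) (φ ψ : form P) :
  formula L φ -> formula L ψ -> derivable L φ ψ -> entails φ ψ.
Proof.
(* Here the team can be fixed before the induction, since no rule of [derivable] leads to another
   team. *)
move=> _ _ der M X satφ; elim: der => {ψ} [|ψ prov|ψ χ _ satψ _ satψχ] //.
- exact: provable_sound prov.
- exact: (satψχ X (@subset_refl _ X) satψ).
Qed.
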